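(* Let $H\in(0,1)$, let $(B^H_t)_{t\ge 0}$ be a fractional Brownian motion with Hurst parameter $H$, let $x_0,y_0\in\mathbb{R}$, and let $\sigma\in C^\infty(\mathbb{R})$ have bounded derivatives of all orders, with $\sigma(x)\neq0$ for all $x\in\mathbb{R}$ (so that $\sigma^2:\mathbb{R}\to(0,\infty)$). Let $X=(X_t)_{t\ge0}$ and $Y=(Y_t)_{t\ge 0}$ be the solutions of $dX_t=\sigma(X_t)\circ dB^H_t$ with $X_0=x_0$ and of $dY_t=\sigma(Y_t)\circ dB^H_t$ with $Y_0=y_0$, respectively. Then for every $t>0$, $$\frac{d}{dt}K(X_t\|Y_t)=-Ht^{2H-1}J_{\sigma^2}(X_t\|Y_t),$$ where $K$ is the Kullback-Leibler divergence and $J_{\sigma^2}(\cdot\|\cdot)$ is the relative Fisher information with respect to $\sigma^2$. In particular, $K(X_t\|Y_t)$ is non-increasing in $t$.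
   Context: A fractional Brownian motion $(B^H_t)_{t\ge0}$ with Hurst parameter $H\in(0,1)$ is a centered Gaussian process with stationary increments and covariance $\mathbb{E}[B^H_sB^H_t]=\tfrac12(t^{2H}+s^{2H}-|t-s|^{2H})$. The equation $dX_t=\sigma(X_t)\circ dB^H_t$, $X_0=x_0$, is understood in the pathwise sense (Young integral for $H\in(1/2,1)$, rough path integral for $H\in(1/4,1)$, symmetric integral for $H\in(1/6,1)$, $m$-order Newton-Cotes functional for general $H\in(0,1)$). Its unique solution is $X_t=\varphi(B^H_t)$, where $\varphi:\mathbb{R}\to\mathbb{R}$ solves the ordinary differential equation $\varphi'(x)=\sigma(\varphi(x))$, $\varphi(0)=x_0$; similarly for $Y$ with $y_0$ in place of $x_0$. For random variables $X,Y$ with probability densities $f_X,f_Y$, the Kullback-Leibler divergence is $K(X\|Y):=\mathbb{E}\big[\ln\frac{f_X(X)}{f_Y(X)}\big]=\int_{\mathbb{R}}f_X(x)\ln\frac{f_X(x)}{f_Y(x)}\,dx$, and for $b:\mathbb{R}\to(0,\infty)$ the relative Fisher information with respect to $b$ is $J_b(X\|Y):=\mathbb{E}\big[b(X)\big(\tfrac{\partial}{\partial x}\ln\frac{f_X(X)}{f_Y(X)}\big)^2\big]$, where the derivative of $\ln(f_X/f_Y)$ is evaluated at $X$. *)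

(* Defs.v *)
From HB Require Import structures.
From mathcomp Require Import all_boot all_order all_algebra.
From mathcomp Require Import all_classical all_reals all_analysis.

Set Implicit Arguments.
Unset Strict Implicit.
Unset Printing Implicit Defensive.

Import Order.TTheory GRing.Theory Num.Theory.
Import numFieldNormedType.Exports.

Local Open Scope classical_set_scope.
Local Open Scope ring_scope.

Section Processes.
Context {d : measure_display} {T : measurableType d} {R : realType}.
Variable P : probability T R.

(* Processes (B_t)_{t >= 0} are families indexed by R; their values at negative
   times are never constrained nor used. *)
Implicit Types (B X : R -> {RV P >-> R}) (Z : T -> R).

(* Degenerate Gaussian laws are point masses; [normal_prob m s] is the Gaussian
   law with standard deviation |s| only when s != 0. *)
Definition gaussian Z : Prop :=
  (exists m s : R, s != 0 /\
     forall A : set R, measurable A -> P (Z @^-1` A) = normal_prob m s A) \/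
  (exists m : R,
     forall A : set R, measurable A -> P (Z @^-1` A) = \d_m A).

Definition gaussian_process B : Prop :=
  forall (n : nat) (t a : 'I_n -> R), (forall i, 0 <= t i) ->
    gaussian (fun w => \sum_(i < n) a i * B (t i) w).

(* The increments (B_{h+t} - B_h)_t and (B_t - B_0)_t have the same
   finite-dimensional distributions; these are compared on measurable
   rectangles, which form a pi-system generating the Borel sets of R^n. *)
Definition stationary_increments B : Prop :=
  forall (h : R) (n : nat) (t : 'I_n -> R) (A : 'I_n -> set R),
    0 <= h -> (forall i, 0 <= t i) -> (forall i, measurable (A i)) ->
    P [set w | forall i, A i (B (h + t i) w - B h w)] =
    P [set w | forall i, A i (B (t i) w - B 0 w)].

Definition fractional_brownian_motion (H : R) B : Prop :=
  [/\ gaussian_process B,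
      (forall t, 0 <= t -> ('E_P[B t] = 0)%E),
      stationary_increments B &
      (forall s t, 0 <= s -> 0 <= t ->
        ('E_P[fun w => (B s w * B t w)%R])%E =
        (2^-1 * (t `^ (2 * H) + s `^ (2 * H) - `|t - s| `^ (2 * H)))%:E)].

(* X solves dX_t = sigma(X_t) o dB_t, X_0 = x0. For a scalar driver and any
   H in (0,1), the pathwise solution (Young, rough path, symmetric or
   Newton-Cotes, according to the range of H) is the Doss-Sussmann process
   X_t = phi(B_t), with phi the flow phi' = sigma o phi, phi(0) = x0. *)
Definition sde_solution (sigma : R -> R) (x0 : R) B X : Prop :=
  exists phi : R -> R,
    [/\ phi 0 = x0,
        (forall x : R, is_derive x 1 phi (sigma (phi x))) &
        {ae P, forall w, forall t, 0 <= t -> X t w = phi (B t w)}].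

End Processes.

(* sigma itself is not required to be bounded *)
Definition smooth_bounded_derivatives {R : realType} (sigma : R -> R) : Prop :=
  (forall (n : nat) (x : R), derivable (sigma^`(n)%classic) x 1) /\
  (forall n : nat, (0 < n)%N ->
     exists M : R, forall x, `|(sigma^`(n)%classic : R -> R) x| <= M).

Section Divergences.
Context {d : measure_display} {T : measurableType d} {R : realType}.
Variable P : probability T R.
Implicit Types X Y : {RV P >-> R}.

Definition is_density X (f : R -> R) : Prop :=
  [/\ measurable_fun setT f, (forall x, 0 <= f x) &
      forall A : set R, measurable A ->
        distribution P X A = (\int[lebesgue_measure]_(x in A) (f x)%:E)%E].

(* The derivative in the Fisher information depends on the version of the
   density: f_X is the continuous one, which is unique when it exists. *)
Definition density X : R -> R :=
  xget (fun=> 0) [set f | is_density X f /\ continuous f].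

(* f_X and f_Y for which ln(f_X/f_Y) is defined and differentiable on R *)
Definition regular_density X (f : R -> R) : Prop :=
  is_density X f /\ (forall x, 0 < f x /\ derivable f x 1).

(* The quotient and the logarithm are those of \bar R (c / 0 = +oo for c > 0
   and lne +oo = +oo), so that K is not artificially finite where f_Y = 0. *)
Definition KL X Y : \bar R :=
  (\int[P]_w lne ((density X (X w))%:E / (density Y (X w))%:E))%E.

Definition relative_fisher (b : R -> R) X Y : \bar R :=
  ('E_P[fun w => (b (X w) *
     ((fun x => ln (density X x / density Y x))^`()%classic (X w)) ^+ 2)%R])%E.

End Divergences.

(* Main.v *)
Require Import Defs.
From HB Require Import structures.
From mathcomp Require Import all_boot all_order all_algebra.
From mathcomp Require Import all_classical all_reals all_analysis.
From mathcomp Require Import measurable_realfun ring lra.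
Import Order.TTheory GRing.Theory Num.Theory.
Import numFieldNormedType.Exports.
Local Open Scope classical_set_scope.
Local Open Scope ring_scope.

Set Implicit Arguments.
Unset Strict Implicit.

(** Both solutions are smooth images of the same Gaussian variable, and in the
    right coordinate they differ by a translation.  Let [phi] and [psi] be the
    flow lines with [X_t = phi(B_t)] and [Y_t = psi(B_t)].  Since [sigma] never
    vanishes, [phi] is a bijection of the line whose inverse [G] has derivative
    [1 / sigma] ([autonomous_flow_inverse]); hence [(G o psi)' = 1] and
    [G (psi x) = x + c] with [c = G (psi 0)] ([autonomous_flow_shift]).  So
    almost surely [G X_t = B_t] and [G Y_t = B_t + c].

    Put [v = t ^ (2 H)], the variance of [B_t], and let [p] be the centered
    Gaussian density of variance [v].  Changing variables by [G]
    ([is_density_change_of_variables]) gives the densities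
    [p (G y) / |sigma y|] for [X_t] and [p (G y - c) / |sigma y|] for [Y_t].
    The Jacobians cancel in the quotient, and
    [ln (f_X / f_Y) = (c^2 - 2 c G) / (2 v)].

    Evaluated at [X_t] this is affine in [B_t], which has mean [0], so
    [K = c^2 / (2 v)].  The derivative of the log-ratio is [- c / (v sigma)], so
    [sigma^2] times the square of that derivative is the constant [c^2 / v^2],
    which is therefore the relative Fisher information
    ([KL_relative_fisher_shifted_flow]).  With [v = t ^ (2 H)] the claimed
    identity is the differentiation of the power [c^2 / 2 * t ^ (- 2 H)].

    Two points need an argument before these formulas apply.  Only the
    first two moments of the Gaussian law of [B_t] are prescribed, so its mean
    and standard deviation parameters have to be recovered from them
    ([gaussian_centered_density]); and the density of a random variable is
    picked among the continuous ones, so these have to be unique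
    ([continuous_density_unique]). *)

(** * Flow lines of a nonvanishing scalar field *)

Lemma is_derive_continuous (R : realType) (f df : R -> R) :
  (forall x, is_derive x (1 : R) f (df x)) -> continuous f.
Proof.
move=> fdf x; apply: differentiable_continuous.
by apply/derivable1_diffP; case: (fdf x).
Qed.

Lemma continuous_neq0_sign (R : realType) (f : R -> R) :
  continuous f -> (forall x, f x != 0) ->
  (forall x, 0 < f x) \/ (forall x, f x < 0).
Proof.
move=> cf f0; suff same x y : 0 < f x -> 0 < f y.
  have [f00|f00] := ltP 0 (f 0); [by left=> x; exact: same f00|right=> x].
  rewrite lt_neqAle f0 /= leNgt; apply/negP => /(same x 0).
  by rewrite ltNge f00.
move=> fx0; rewrite lt_neqAle eq_sym f0 /= leNgt; apply/negP => fy0.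
have key a b : a <= b ->
    Num.min (f a) (f b) <= 0 <= Num.max (f a) (f b) -> False.
  move=> ab fab; have [|c _ fc0] := @IVT R f a b 0 ab _ fab.
    exact: continuous_subspaceT.
  by have := f0 c; rewrite fc0 eqxx.
have [xy|yx] := leP x y.
  by apply: (key x y) => //; rewrite ge_min le_max (ltW fx0) (ltW fy0) orbT.
by apply: (key y x (ltW yx)); rewrite ge_min le_max (ltW fx0) (ltW fy0) orbT.
Qed.

(** A flow line that misses [y] stays below it by the intermediate value
    theorem, hence between [phi 0] and [y] for positive times;
    there its speed is bounded below by a positive constant, so it reaches [y]
    in finite time after all. *)
Lemma autonomous_flow_reaches_above (R : realType) (sigma phi : R -> R)
  (y : R) :
  continuous sigma -> (forall x, 0 < sigma x) ->
  (forall x, is_derive x (1 : R) phi (sigma (phi x))) ->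
  phi 0 <= y -> exists x, phi x = y.
Proof.
move=> csigma sigma_gt0 dphi phi0y; apply: contrapT => /forallNP phiNy.
have cphi : continuous phi := is_derive_continuous dphi.
have csub (f : R -> R) (a b : R) :
    continuous f -> {within `[a, b], continuous f}.
  by move=> cf; exact: continuous_subspaceT.
have below x : 0 <= x -> phi x < y.
  move=> x0; rewrite ltNge; apply/negP => yphix.
  have [|c _ phic] := @IVT R phi 0 x y x0 (csub _ _ _ cphi).
    by rewrite ge_min le_max phi0y yphix orbT.
  exact: phiNy phic.
have [m _ mmin] := EVT_min phi0y (csub _ _ _ csigma).
have nondec x z : x <= z -> phi x <= phi z.
  move=> xz; have [c _] := @MVT_segment R phi (sigma \o phi) x z xz
    (fun u _ => dphi u) (csub _ _ _ cphi).
  by rewrite -subr_ge0 => ->; rewrite mulr_ge0 ?subr_ge0//= ltW.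
(* travel time from [phi 0] to [y] at the minimal speed [sigma m] *)
pose x := (y - phi 0) / sigma m.
have x0 : 0 <= x by rewrite divr_ge0 ?subr_ge0// ltW.
have [c c0x] := @MVT_segment R phi (sigma \o phi) 0 x x0 (fun u _ => dphi u)
  (csub _ _ _ cphi).
have /andP[c0 cx] : 0 <= c <= x by rewrite in_itv in c0x.
have sm : sigma m <= sigma (phi c).
  by apply: mmin; rewrite in_itv/= nondec//= ltW// below.
rewrite subr0 => E; have : y - phi 0 <= phi x - phi 0.
  rewrite E; apply: (@le_trans _ _ (sigma m * x)).
    by rewrite /x mulrC divfK// gt_eqF.
  exact: ler_wpM2r.
by rewrite lerD2r leNgt below.
Qed.

(** The other sign of [sigma] and the targets below [phi 0] reduce to
    [autonomous_flow_reaches_above] by reversing time or reflecting space. *)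
Lemma autonomous_flow_surjective (R : realType) (sigma phi : R -> R)
  (y : R) :
  continuous sigma -> (forall x, sigma x != 0) ->
  (forall x, is_derive x (1 : R) phi (sigma (phi x))) -> exists x, phi x = y.
Proof.
have pos (s f : R -> R) z : continuous s -> (forall x, 0 < s x) ->
    (forall x, is_derive x (1 : R) f (s (f x))) -> exists x, f x = z.
  move=> cs s0 df; have [fz|zf] := leP (f 0) z.
    exact: autonomous_flow_reaches_above df fz.
  pose f' x := - f (- x).
  have [||||x fx] := @autonomous_flow_reaches_above R (s \o -%R) f' (- z).
  - by move=> u; apply: continuous_comp; [exact: opp_continuous|exact: cs].
  - by move=> u; exact: s0.
  - move=> u; rewrite /f'/= opprK.
    have := df (- u) => dfu; apply: is_derive_eq; ring.
  - by rewrite /f' oppr0 lerN2 ltW.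
  by exists (- x); apply: oppr_inj.
move=> csigma /(continuous_neq0_sign csigma)[sigma0|sigma0] dphi.
  exact: pos dphi.
have [|||x <-] := pos (fun x => - sigma x) (fun x => phi (- x)) y.
- by move=> u; apply: continuousN; exact: csigma.
- by move=> u; rewrite oppr_gt0.
- by move=> u; have := dphi (- u) => dphiu; apply: is_derive_eq; ring.
by exists (- x).
Qed.

Lemma autonomous_flow_inverse (R : realType) (sigma phi : R -> R) :
  continuous sigma -> (forall x, sigma x != 0) ->
  (forall x, is_derive x (1 : R) phi (sigma (phi x))) ->
  exists G : R -> R, cancel phi G /\
    (forall y, is_derive y (1 : R) G (sigma y)^-1).
Proof.
move=> csigma sigma0 dphi.
have cphi : continuous phi := is_derive_continuous dphi.
have inj x z : x < z -> phi x != phi z.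
  move=> xz; rewrite eq_sym -subr_eq0.
  have [c _ ->] := @MVT R phi (sigma \o phi) x z xz (fun u _ => dphi u)
    (continuous_subspaceT cphi).
  by rewrite mulf_neq0//= subr_eq0 gt_eqF.
have [G GK] := choice
  (fun y => @autonomous_flow_surjective _ _ _ y csigma sigma0 dphi).
have phiK : cancel phi G.
  by move=> x; case: (ltgtP (G (phi x)) x) => // xGx; have := inj _ _ xGx;
    rewrite GK eqxx.
exists G; split => // y; rewrite -(GK y).
apply: is_derive_inverse => //; apply: filterE => ?; [exact: phiK|exact: cphi].
Qed.

(** The time coordinate [G] straightens every flow line, since
    [(G o psi)' = sigma (psi) / sigma (psi) = 1]. *)
Lemma autonomous_flow_shift (R : realType) (sigma psi G : R -> R) :
  (forall x, sigma x != 0) ->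
  (forall x, is_derive x (1 : R) psi (sigma (psi x))) ->
  (forall y, is_derive y (1 : R) G (sigma y)^-1) ->
  forall x, G (psi x) = x + G (psi 0).
Proof.
move=> sigma0 dpsi dG x.
have d0 z : is_derive z (1 : R) (fun u => G (psi u) - u) 0.
  have := dpsi z => dpsiz; have := dG (psi z) => dGz.
  have -> : (fun u => G (psi u) - u) = (G \o psi) \- id by [].
  by apply: is_derive_eq; rewrite mulVf ?subrr.
by have := is_derive_0_is_cst x 0 d0; rewrite subr0 => <-; rewrite addrC subrK.
Qed.

(** * Continuous densities and change of variables *)

Lemma ae_iff_measure_eq (d : measure_display) (T : measurableType d)
  (R : realType) (mu : {measure set T -> \bar R}) (A B : set T) :
  measurable A -> measurable B -> {ae mu, forall w, A w <-> B w} ->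
  mu A = mu B.
Proof.
move=> mA mB AB; rewrite -[A]setIT -[B]setIT -!integral_indic//.
apply: ge0_ae_eq_integral => //.
- exact/measurable_EFinP/measurable_indic.
- exact/measurable_EFinP/measurable_indic.
apply: filterS AB => w AB _; rewrite !indicE; congr (_%:R%:E).
by congr nat_of_bool; apply/idP/idP; rewrite !inE => /AB.
Qed.

Lemma measure_eq_ocitv (R : realType) (mu nu : {measure set R -> \bar R}) :
  (mu setT < +oo)%E ->
  (forall a b : R, a < b -> mu `]a, b]%classic = nu `]a, b]%classic) ->
  forall A, measurable A -> mu A = nu A.
Proof.
move=> mufin munu A mA.
apply: (measure_unique (@ocitv R) (fun k => `](- k%:R), k%:R]%classic)) => //.
- exact: ocitvI.
- by move=> k; exact: is_ocitv.
- apply/seteqP; split=> // x _.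
  exists (Num.bound `|x|) => //=; rewrite in_itv/=.
  by have := archi_boundP (normr_ge0 x); rewrite ltr_norml => /andP[-> /ltW ->].
- move=> _ [[a b] _ <-] /=; have [ab|ba] := ltP a b; first exact: munu.
  by rewrite set_itv_ge ?measure0// bnd_simp -leNgt.
- move=> k; apply: le_lt_trans mufin; apply: le_measure; rewrite ?inE//.
Qed.

(** Packaging [A |-> \int_A f] as a measure makes the uniqueness theorem for
    measures available to compare it with the law of a random variable. *)
Lemma measure_with_density (R : realType) (f : R -> R) :
  measurable_fun setT f -> (forall x, 0 <= f x) ->
  exists nu : {measure set R -> \bar R}, forall A,
    nu A = (\int[lebesgue_measure]_(x in A) (f x)%:E)%E.
Proof.
move=> mf f0.
pose nu (A : set R) := (\int[lebesgue_measure]_(x in A) (f x)%:E)%E.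
have nu0 : nu set0 = 0%E by rewrite /nu integral_set0.
have nu_ge0 A : (0 <= nu A)%E by apply: integral_ge0 => x _; rewrite lee_fin.
have nu_sigma : semi_sigma_additive nu.
  move=> /= F mF tF mUF; rewrite /nu; apply: cvg_toP.
    apply: ereal_nondecreasing_is_cvgn => m n mn.
    apply: lee_sum_nneg_natr => // k _ _.
    by apply: integral_ge0 => /= x Fkx; rewrite lee_fin.
  rewrite ge0_integral_bigcup//=.
  - exact/measurable_funTS/measurable_EFinP.
  - by move=> x _; rewrite lee_fin.
pose nuM : {measure set R -> \bar R} :=
  HB.pack nu (isMeasure.Build _ _ _ nu nu0 nu_ge0 nu_sigma).
by exists nuM.
Qed.

(** The set where two continuous functions differ is open, and a nonempty
    open set has positive length. *)
Lemma ae_eq_continuous_eq (R : realType) (f g : R -> R) :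
  continuous f -> continuous g -> {ae lebesgue_measure, forall x, f x = g x} ->
  f = g.
Proof.
move=> cf cg [N [mN N0 fgN]]; apply/funext => x; apply: contrapT => fgx.
have : \forall y \near x, f y - g y != 0.
  have cfg : {for x, continuous (f \- g)}.
    by apply: continuousB; [exact: cf|exact: cg].
  apply: (cvgr_neq0 (f x - g x) cfg).
  by rewrite subr_eq0; exact/eqP.
move=> /nbhs_ballP[e /= e0 fgball].
have : (lebesgue_measure (ball x e) <= lebesgue_measure N)%E.
  apply: le_measure; rewrite ?inE//; first exact: measurable_ball.
  move=> y xy; apply: fgN => /= fgy.
  by have := fgball y xy; rewrite fgy subrr eqxx.
rewrite N0 lebesgue_measure_ball ?(ltW e0)// lee_fin pmulrn_lle0// leNgt.
by rewrite e0.
Qed.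

Lemma continuous_density_unique (d : measure_display) (T : measurableType d)
  (R : realType) (P : probability T R) (X : {RV P >-> R}) (f g : R -> R) :
  is_density X f -> is_density X g -> continuous f -> continuous g -> f = g.
Proof.
move=> [mf f0 fX] [mg g0 gX] cf cg; apply: ae_eq_continuous_eq => //.
have /measurable_EFinP mF := mf; have /measurable_EFinP mG := mg.
have fint : lebesgue_measure.-integrable setT (EFin \o f).
  apply/integrableP; split => //.
  under eq_integral do rewrite /= ger0_norm//.
  by rewrite -fX//= probability_setT ltry.
have := integral_ae_eq measurableT fint mG.
case=> [E _ mE|N [mN N0 fgN]]; first by rewrite /= -fX// -gX.
exists N; split => // x /= fgx; apply: fgN => /= /(_ I) [] /fgx.
exact.
Qed.

Lemma density_eq (d : measure_display) (T : measurableType d)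
  (R : realType) (P : probability T R) (X : {RV P >-> R}) (f : R -> R) :
  is_density X f -> continuous f -> density X = f.
Proof.
move=> fX cf; rewrite /density.
case: xgetP => [g _ [gX cg]|/(_ f)[]//].
exact: continuous_density_unique gX fX cg cf.
Qed.

Lemma is_density_ocitv (d : measure_display) (T : measurableType d)
  (R : realType) (P : probability T R) (X : {RV P >-> R}) (f : R -> R) :
  continuous f -> (forall x, 0 <= f x) ->
  (forall a b, a < b -> distribution P X `]a, b]%classic =
     (\int[lebesgue_measure]_(x in `[a, b]) (f x)%:E)%E) ->
  is_density X f.
Proof.
move=> cf f0 fX; have mf : measurable_fun setT f.
  exact: continuous_measurable_fun.
split => // A mA; have [nu nuE] := @measure_with_density R f mf f0.
rewrite -nuE; apply: measure_eq_ocitv mA.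
  by apply: le_lt_trans (ltry 1); exact: probability_le1.
move=> a b ab; rewrite nuE; apply: etrans (fX a b ab) _.
rewrite integral_itv_obnd_cbnd//.
exact/measurable_funTS/measurable_EFinP.
Qed.

(** Stated through the inverse map [G] alone: [Z = G X] almost surely, and [G]
    is strictly monotone, so [X] lies between [a] and [b] exactly when [Z] lies
    between [G a] and [G b]; there the substitution rule applies.
    A decreasing [G] exchanges the endpoints, and the sign this brings is
    absorbed by the absolute value. *)
Lemma is_density_change_of_variables (d : measure_display)
  (T : measurableType d) (R : realType) (P : probability T R)
  (Z X : {RV P >-> R}) (p G g : R -> R) :
  is_density Z p -> continuous p ->
  (forall y, is_derive y (1 : R) G (g y)) -> continuous g ->
  (forall y, g y != 0) ->
  {ae P, forall w, Z w = G (X w)} ->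
  is_density X (fun y => p (G y) * `|g y|).
Proof.
move=> [mp p0 pZ] cp dG cg gn0 ZGX.
have cG : continuous G := is_derive_continuous dG.
have G'E : (G^`())%classic = g.
  by apply/funext => y; rewrite derive1E derive_val.
have LR a b : derivable_oo_LRcontinuous G a b.
  split=> [x _||]; [by case: (dG x)| |].
  - exact/cvg_at_right_filter/cG.
  - exact/cvg_at_left_filter/cG.
have mEp A : measurable A -> measurable_fun A (EFin \o p).
  by move=> mA; exact/measurable_funTS/measurable_EFinP.
have HMVT a b : a < b -> exists c, G b - G a = g c * (b - a).
  move=> ab; have [c _ E] := @MVT R G g a b ab (fun u _ => dG u)
    (continuous_subspaceT cG).
  by exists c.
apply: is_density_ocitv.
- move=> y; apply: cvgM.
    by apply: continuous_comp; [exact: cG|exact: cp].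
  by apply: continuous_comp; [exact: cg|exact: norm_continuous].
- by move=> y; rewrite mulr_ge0.
move=> a b ab.
have [g0|g0] := continuous_neq0_sign cg gn0.
- have Gmono x y : x < y -> G x < G y.
    move=> xy; rewrite -subr_gt0; have [c ->] := HMVT _ _ xy.
    by rewrite mulr_gt0// subr_gt0.
  have Gle : {mono G : x y / x <= y} by apply: le_mono => x y; exact: Gmono.
  have Glt : {mono G : x y / x < y} by exact: leW_mono.
  transitivity (distribution P Z `]G a, G b]%classic).
    apply: (@ae_iff_measure_eq _ _ _ P (X @^-1` _) (Z @^-1` _));
      [exact: measurable_funPTI|exact: measurable_funPTI|].
    by apply: filterS ZGX => w /= ->; rewrite !in_itv/= Glt Gle.
  rewrite pZ// integral_itv_obnd_cbnd; last exact: mEp.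
  rewrite integration_by_substitution_increasing ?ltW//.
  - by apply: eq_integral => x _; rewrite /= G'E gtr0_norm.
  - by move=> x y _ _; exact: Gmono.
  - by rewrite G'E => x _; exact: cg.
  - by rewrite G'E; apply/cvg_ex; exists (g a); exact/cvg_at_right_filter/cg.
  - by rewrite G'E; apply/cvg_ex; exists (g b); exact/cvg_at_left_filter/cg.
  - exact: continuous_subspaceT.
- have Gmono x y : x < y -> G y < G x.
    move=> xy; rewrite -subr_lt0; have [c ->] := HMVT _ _ xy.
    by rewrite nmulr_rlt0// subr_gt0.
  have Gle : {mono G : x y /~ x <= y} by apply: le_nmono => x y; exact: Gmono.
  have Glt : {mono G : x y /~ x < y} by exact: leW_nmono.
  transitivity (distribution P Z `[G b, G a[%classic).
    apply: (@ae_iff_measure_eq _ _ _ P (X @^-1` _) (Z @^-1` _));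
      [exact: measurable_funPTI|exact: measurable_funPTI|].
    by apply: filterS ZGX => w /= ->; rewrite !in_itv/= Glt Gle andbC.
  rewrite pZ// integral_itv_bndo_bndc; last exact: mEp.
  rewrite integration_by_substitution_decreasing ?ltW//.
  - by apply: eq_integral => x _; rewrite /= G'E ltr0_norm.
  - by move=> x y _ _; exact: Gmono.
  - by rewrite G'E => x _; exact: cg.
  - by rewrite G'E; apply/cvg_ex; exists (g a); exact/cvg_at_right_filter/cg.
  - by rewrite G'E; apply/cvg_ex; exists (g b); exact/cvg_at_left_filter/cg.
  - exact: continuous_subspaceT.
Qed.

(** * Identification of the Gaussian law from its moments *)

(** The density is almost everywhere the Radon-Nikodym derivative of the law
    of [X], by uniqueness of the latter. *)
Lemma ge0_integral_density (d : measure_display) (T : measurableType d)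
  (R : realType) (P : probability T R) (X : {RV P >-> R}) (f h : R -> R) :
  is_density X f -> measurable_fun setT h -> (forall x, 0 <= h x) ->
  (\int[P]_w (h (X w))%:E = \int[lebesgue_measure]_x (h x * f x)%:E)%E.
Proof.
move=> [mf f0 fX] mh h0.
have mf' : measurable_fun setT (EFin \o f) by exact/measurable_EFinP.
have mh' : measurable_fun setT (EFin \o h) by exact/measurable_EFinP.
(* [X'] is [X] with values in the copy of the line on which Lebesgue measure is
   built, so that its law and Lebesgue measure live on the same type *)
have mX : measurable_fun setT (X : T -> measurableTypeR R).
  by move=> _ A mA; rewrite setTI; exact: (@measurable_funPTI _ _ _ _ X A).
pose X' : {RV P >-> measurableTypeR R} :=
  HB.pack (X : T -> measurableTypeR R) (isMeasurableFun.Build _ _ _ _ _ mX).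
pose nu : {finite_measure set (measurableTypeR R) -> \bar R} :=
  distribution P X'.
have nuE A : measurable A ->
    nu A = (\int[lebesgue_measure]_(x in A) (f x)%:E)%E.
  exact: fX.
have dom : nu `<< lebesgue_measure.
  apply/null_content_dominatesP => A mA A0; rewrite nuE//.
  by rewrite null_set_integral//; exact: measurable_funTS.
have h0' x : (0 <= (EFin \o h) x)%E by rewrite lee_fin.
transitivity (\int[nu]_x (EFin \o h) x)%E.
  by rewrite -(@ge0_integral_distribution _ _ _ _ _ P X' (EFin \o h)).
rewrite -(Radon_Nikodym_SigmaFinite.change_of_variables dom)//.
pose rn := Radon_Nikodym_SigmaFinite.f nu lebesgue_measure.
have rnint := Radon_Nikodym_SigmaFinite.f_integrable dom.
have mrn := measurable_int _ rnint.
apply: ae_eq_integral => //.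
- exact: emeasurable_funM.
- apply/measurable_EFinP; exact: measurable_funM.
have : ae_eq lebesgue_measure setT rn (EFin \o f).
  apply: integral_ae_eq => // E _ mE.
  by rewrite -(Radon_Nikodym_SigmaFinite.f_integral dom)// nuE.
by apply: filterS => x rnf _; rewrite EFinM; congr (_ * _)%E; exact: rnf.
Qed.

Lemma is_derive_normal_pdf (R : realType) (s x : R) : s != 0 ->
  is_derive x (1 : R) (normal_pdf 0 s) (- (x / s ^+ 2) * normal_pdf 0 s x).
Proof.
move=> s0; rewrite normal_pdfE//.
have -> : (fun x => normal_peak s * normal_fun 0 s x) =
    normal_peak s *: (expR \o (fun x => - (s ^+ 2 *+ 2)^-1 * x ^+ 2)).
  apply/funext => y; rewrite /normal_fun subr0/=; congr (_ * expR _).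
  by rewrite mulNr mulNr mulrC.
apply: is_derive_eq.
rewrite /normal_fun subr0 /= /GRing.scale /=.
have -> : - x ^+ 2 / (s ^+ 2 *+ 2) = - (s ^+ 2 *+ 2)^-1 * x ^+ 2.
  by rewrite mulNr mulNr mulrC.
by set e := expR _; field.
Qed.

Lemma cvg_mulr_normal_pdf (R : realType) (s : R) : s != 0 ->
  n.+1%:R * normal_pdf 0 s n.+1%:R @[n --> \oo] --> (0 : R).
Proof.
move=> s0; have s2 : 0 < s ^+ 2 by rewrite exprn_even_gt0.
(* [expR u >= u] with [u = x^2 / (2 s^2)] gives [x p(x) <= K / x] *)
pose K := normal_peak s * (s ^+ 2 *+ 2).
apply: (@squeeze_cvgr _ _ _ _ (cst 0) (fun n => K * harmonic n)).
- apply: nearW => n; rewrite mulr_ge0 ?normal_pdf_ge0//=.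
  rewrite normal_pdfE// /K -mulrA mulrCA ler_pM2l ?normal_peak_gt0//.
  rewrite /normal_fun subr0 mulNr expRN /harmonic /=.
  set x : R := n.+1%:R; have x0 : 0 < x by rewrite ltr0n.
  have := expR_ge1Dx (x ^+ 2 / (s ^+ 2 *+ 2)).
  set u := x ^+ 2 / _ => eu.
  have u0 : 0 < u by rewrite divr_gt0// ?exprn_gt0// pmulrn_lgt0.
  have -> : s ^+ 2 *+ 2 * x^-1 = x / u.
    rewrite /u; field; rewrite s0 gt_eqF//.
  rewrite ler_pM2l// lef_pV2 ?posrE ?expR_gt0//.
  by apply: le_trans eu; rewrite lerDr.
- exact: cvg_cst.
- rewrite -[X in _ --> X](mulr0 K); apply: cvgMl_tmp; exact: cvg_harmonic.
Qed.

(** Integration by parts: [x p(x)] has derivative [p - (x^2 / s^2) p], so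
    between [-n] and [n] the integral of [x^2 p] is [s^2] times that of [p],
    up to the boundary term [2 s^2 n p(n)], which vanishes in the limit. *)
Lemma normal_second_moment (R : realType) (s : R) : s != 0 ->
  (\int[lebesgue_measure]_x (x ^+ 2 * normal_pdf 0 s x)%:E = (s ^+ 2)%:E)%E.
Proof.
move=> s0; pose p := normal_pdf 0 s; pose mu := @lebesgue_measure R.
have cp : continuous p by exact: continuous_normal_pdf.
have cq : continuous (fun x : R => x ^+ 2 * p x).
  by move=> x; apply: cvgM; [exact: exprn_continuous|exact: cp].
pose I n : set R := `[- n.+1%:R, n.+1%:R]%classic.
have IT : \bigcup_n I n = setT.
  apply/seteqP; split=> // x _; exists (Num.bound `|x|) => //.
  rewrite /I /= in_itv/= -ler_norml.
  by rewrite (le_trans (ltW (archi_boundP (normr_ge0 x))))// ler_nat.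
have ndI : nondecreasing_seq I.
  move=> m n mn; apply/subsetPset/subset_itv; rewrite bnd_simp.
    by rewrite lerN2 ler_nat.
  by rewrite ler_nat.
have lim (f : R -> R) : continuous f -> (forall x, 0 <= f x) ->
    (\int[mu]_(x in I n) (f x)%:E @[n --> \oo] --> \int[mu]_x (f x)%:E)%E.
  move=> cf f0; rewrite -IT; apply: ge0_nondecreasing_set_cvg_integral => //.
  - by move=> n; exact: measurable_itv.
  - move=> n; apply/measurable_funTS/measurable_EFinP.
    exact: continuous_measurable_fun.
  - by move=> n x _; rewrite lee_fin.
have parts n : (\int[mu]_(x in I n) (x ^+ 2 * p x)%:E =
    (s ^+ 2)%:E * \int[mu]_(x in I n) (p x)%:E -
    (s ^+ 2 *+ 2 * (n.+1%:R * p n.+1%:R))%:E)%E.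
  have intI (f : R -> R) : continuous f -> mu.-integrable (I n) (EFin \o f).
    move=> cf; apply: continuous_compact_integrable.
      exact: segment_compact.
    exact: continuous_subspaceT.
  pose F x := s ^+ 2 * (x * p x).
  have dF x : is_derive x (1 : R) F (s ^+ 2 * p x - x ^+ 2 * p x).
    have dp := is_derive_normal_pdf x s0.
    have -> : F = s ^+ 2 *: (id * p) by [].
    apply: is_derive_eq; rewrite /GRing.scale/= -/p; field.
    exact: s0.
  have cF := is_derive_continuous dF.
  have csp : continuous (fun x : R => s ^+ 2 * p x).
    by move=> x; apply: cvgM; [exact: cvg_cst|exact: cp].
  have NN : - n.+1%:R < n.+1%:R :> R by rewrite gtrN.
  have := @continuous_FTC2 R (fun x => s ^+ 2 * p x - x ^+ 2 * p x) F _ _ NN.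
  have -> : F (- n.+1%:R) = - (s ^+ 2 * (n.+1%:R * p n.+1%:R)).
    rewrite /F /p normal_pdfE// /normal_fun !subr0 sqrrN; ring.
  rewrite -/(I n) -/mu => FTC.
  have {}FTC : (\int[mu]_(x in I n) (s ^+ 2 * p x - x ^+ 2 * p x)%:E =
      (s ^+ 2 *+ 2 * (n.+1%:R * p n.+1%:R))%:E)%E.
    rewrite FTC; first by rewrite -EFinB /F; congr EFin; ring.
    - apply: continuous_subspaceT => x; apply: cvgB; [exact: csp|exact: cq].
    - split=> [x _||]; first by case: (dF x).
        exact/cvg_at_right_filter/cF.
      exact/cvg_at_left_filter/cF.
    - by move=> x _; rewrite derive1E derive_val.
  have mI : measurable (I n) by exact: measurable_itv.
  rewrite -FTC -integralZl//; last exact: intI.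
  rewrite -integralB_EFin//; [|exact: intI|].
    by apply: eq_integral => x _; rewrite -EFinB; congr EFin; ring.
  by apply: intI => x; apply: cvgB; [exact: csp|exact: cq].
have q0 x : 0 <= x ^+ 2 * p x by rewrite mulr_ge0 ?sqr_ge0 ?normal_pdf_ge0.
have h1 := lim _ cq q0; rewrite (funext parts) in h1.
apply: (cvg_unique (@ereal_hausdorff R) h1) => /=.
rewrite -[(s ^+ 2)%:E in X in _ X]mule1 -[(_ * 1)%E]adde0.
apply: cvgeD => //.
- rewrite -(integral_normal_pdf 0 s); apply: cvgeZl => //; apply: lim => // x.
  exact: normal_pdf_ge0.
- apply: cvg_EFin; first exact: nearW.
  rewrite -[X in _ --> X]oppr0 -[X in _ --> - X](mulr0 (s ^+ 2 *+ 2)).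
  by apply: cvgN; apply: cvgMl_tmp; exact: cvg_mulr_normal_pdf.
Qed.

Lemma integrable_of_second_moment (d : measure_display) (T : measurableType d)
  (R : realType) (P : probability T R) (Z : {RV P >-> R}) (v : R) :
  (\int[P]_w (Z w ^+ 2)%:E = v%:E)%E -> P.-integrable setT (EFin \o Z).
Proof.
move=> Zv.
have mZ2 : measurable_fun setT (fun w => Z w ^+ 2) by exact: measurable_funX.
have iZ2 : P.-integrable setT (fun w => (Z w ^+ 2)%:E).
  apply/integrableP; split; first exact/measurable_EFinP.
  under eq_integral do rewrite gee0_abs ?lee_fin ?sqr_ge0//.
  by rewrite Zv ltry.
have i1 : P.-integrable setT (fun=> 1%:E).
  exact: (finite_measure_integrable_cst P 1 measurableT).
apply: le_integrable (integrableD measurableT i1 iZ2) => //.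
- exact/measurable_EFinP.
- move=> w _; rewrite /= lee_fin [leRHS]ger0_norm ?addr_ge0 ?sqr_ge0//.
  rewrite -real_normK ?num_real//; set a := `|Z w|.
  have a0 : 0 <= a by exact: normr_ge0.
  nra.
Qed.

Lemma dirac_law_moments (d : measure_display) (T : measurableType d)
  (R : realType) (P : probability T R) (Z : {RV P >-> R}) (m : R) :
  (forall A : set R, measurable A -> P (Z @^-1` A) = \d_m A) ->
  (\int[P]_w (Z w)%:E = m%:E)%E /\ (\int[P]_w (Z w ^+ 2)%:E = (m ^+ 2)%:E)%E.
Proof.
move=> Zm; have aeZ : {ae P, forall w, Z w = m}.
  exists (Z @^-1` [set~ m]); split => //.
    by apply: measurable_funPTI; exact: measurableC.
  rewrite Zm; last exact: measurableC.
  by rewrite diracE memNset//= => /(_ erefl).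
have mZ : measurable_fun setT Z by [].
have int_cst (c : R) : (\int[P]_w c%:E = c%:E)%E.
  by rewrite integral_cst//= probability_setT mule1.
split.
- rewrite -[RHS]int_cst; apply: ae_eq_integral => //.
  + exact/measurable_EFinP.
  + by apply: filterS aeZ => w -> _.
- rewrite -[RHS]int_cst; apply: ae_eq_integral => //.
  + by apply/measurable_EFinP; exact: measurable_funX.
  + by apply: filterS aeZ => w -> _.
Qed.

(** The reflection [2 m - Z] has the same density as [Z], hence the same
    expectation, which forces it to be [m]. *)
Lemma normal_law_mean (d : measure_display) (T : measurableType d)
  (R : realType) (P : probability T R) (Z : {RV P >-> R}) (m s : R) :
  s != 0 -> is_density Z (normal_pdf m s) ->
  P.-integrable setT (EFin \o Z) -> (\int[P]_w (Z w)%:E = m%:E)%E.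
Proof.
move=> s0 dZ iZ.
have mX : measurable_fun setT (fun w => 2 * m - Z w).
  exact: measurable_funB.
pose X : {RV P >-> R} :=
  HB.pack (fun w => 2 * m - Z w) (isMeasurableFun.Build _ _ _ _ _ mX).
have dX : is_density X (normal_pdf m s).
  have -> : normal_pdf m s = fun y => normal_pdf m s (2 * m - y) * `|-1|.
    apply/funext => y; rewrite normrN1 mulr1 normal_pdfE//; congr (_ * _).
    by rewrite /normal_fun; congr (expR (- _ / _)); ring.
  apply: (@is_density_change_of_variables _ _ _ P Z X _ (fun y => 2 * m - y)
    (fun=> -1)) => //.
  - exact: continuous_normal_pdf.
  - by move=> y; apply: is_derive_eq; rewrite add0r mul1r.
  - by move=> y; exact: cvg_cst.
  - by apply: aeW => w /=; ring.
have iX : P.-integrable setT (EFin \o X).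
  apply: (@integrableB _ _ _ P setT measurableT (cst (2 * m)%:E)
    (EFin \o Z)) => //.
  exact: (finite_measure_integrable_cst P (2 * m) measurableT).
have XZ : (\int[P]_w (X w)%:E = \int[P]_w (Z w)%:E)%E.
  have mid : measurable_fun [set: R] (@EFin R) by exact/measurable_EFinP.
  have <- := integral_distribution mid iX.
  have <- := integral_distribution mid iZ.
  apply: eq_measure_integral => A mA _.
  have [_ _ dXE] := dX; have [_ _ dZE] := dZ.
  by apply: etrans (dXE A mA) _; apply/esym/dZE.
have : (\int[P]_w (X w)%:E = (2 * m)%:E - \int[P]_w (Z w)%:E)%E.
  rewrite (integralB_EFin measurableT (f1 := cst (2 * m)))//.
    congr (_ - _)%E; have /= -> := integral_cst P measurableT (2 * m)%:E.
    by rewrite probability_setT mule1.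
  exact: (finite_measure_integrable_cst P (2 * m) measurableT).
rewrite XZ; have := integrable_fin_num measurableT iZ.
rewrite /=; case: (\int[P]_w (Z w)%:E)%E => // r _ [] E; congr EFin; lra.
Qed.

(** The degenerate alternative would make the variance zero.  Since [v] only
    determines the square of the standard deviation parameter, that parameter
    may be negative; the Gaussian density depends on its square alone. *)
Lemma gaussian_centered_density (d : measure_display) (T : measurableType d)
  (R : realType) (P : probability T R) (Z : {RV P >-> R}) (v : R) :
  gaussian P Z -> (\int[P]_w (Z w)%:E = 0)%E ->
  (\int[P]_w (Z w ^+ 2)%:E = v%:E)%E -> 0 < v ->
  is_density Z (normal_pdf 0 (Num.sqrt v)).
Proof.
move=> [[m [s [s0 Zms]]]|[m Zm]] EZ EZ2 v0; last first.
  have [] := dirac_law_moments Zm; rewrite EZ EZ2 => -[<-] [].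
  by rewrite expr0n/= => v00; rewrite v00 ltxx in v0.
have dZ : is_density Z (normal_pdf m s).
  split; [exact: measurable_normal_pdf|exact: normal_pdf_ge0|].
  by move=> A mA; exact: Zms.
have := normal_law_mean s0 dZ (integrable_of_second_moment EZ2).
rewrite EZ => -[m0]; rewrite -m0 in dZ.
have := normal_second_moment s0.
have msq : measurable_fun [set: R] (fun x : R => x ^+ 2).
  exact: measurable_funX.
rewrite -(@ge0_integral_density _ _ _ P Z _ _ dZ msq (fun x => sqr_ge0 x)).
rewrite EZ2 => -[vs].
suff -> : normal_pdf 0 (Num.sqrt v) = normal_pdf 0 s by [].
have sv0 : Num.sqrt v != 0 by rewrite sqrtr_eq0 -ltNge.
apply/funext => x; rewrite !normal_pdfE// /normal_peak /normal_fun.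
by rewrite sqr_sqrtr ?ltW// vs.
Qed.

(** * Divergences between two flow lines driven by one Gaussian variable *)

Lemma flow_density (d : measure_display) (T : measurableType d)
  (R : realType) (P : probability T R) (Z X : {RV P >-> R})
  (sigma G : R -> R) (s : R) :
  s != 0 -> is_density Z (normal_pdf 0 s) ->
  (forall y, derivable sigma y 1) -> (forall y, sigma y != 0) ->
  (forall y, is_derive y (1 : R) G (sigma y)^-1) ->
  {ae P, forall w, Z w = G (X w)} ->
  density X = (fun y => normal_pdf 0 s (G y) * `|(sigma y)^-1|) /\
  regular_density X (density X).
Proof.
move=> s0 dZ dsigma sigma0 dG ZGX.
have csigma : continuous sigma.
  by move=> y; apply/differentiable_continuous/derivable1_diffP.
have cV : continuous (fun y => (sigma y)^-1).
  by move=> y; apply: cvgV; [exact: sigma0|exact: csigma].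
have V0 y : (sigma y)^-1 != 0 by rewrite invr_neq0.
have cp : continuous (normal_pdf 0 s) by exact: continuous_normal_pdf.
pose f y := normal_pdf 0 s (G y) * `|(sigma y)^-1|.
have fX : is_density X f.
  exact: is_density_change_of_variables dZ cp dG cV V0 ZGX.
have df y : derivable f y 1.
  (* [sigma] has constant sign, so the absolute value is a constant factor *)
  have [e fE] : exists e : R, f = fun y =>
      e * (normal_pdf 0 s (G y) * (sigma y)^-1).
    have [V_gt0|V_lt0] := continuous_neq0_sign cV V0.
      by exists 1; apply/funext => z; rewrite mul1r /f gtr0_norm.
    by exists (-1); apply/funext => z; rewrite mulN1r /f ltr0_norm// mulrN.
  have dp := is_derive_normal_pdf (G y) s0; have dGy := dG y.
  rewrite fE; apply: derivableM; first exact: derivable_cst.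
  apply: derivableM; last exact: derivableV.
  by have [] := is_derive1_comp dp dGy.
have cf : continuous f.
  by move=> y; apply/differentiable_continuous/derivable1_diffP.
rewrite (density_eq fX cf); split=> //; split=> // y; split=> //.
rewrite mulr_gt0 ?normr_gt0// normal_pdfE// mulr_gt0 ?expR_gt0//.
exact: normal_peak_gt0.
Qed.

(** The log-ratio of the densities is the affine function
    [l = (c^2 - 2 c G) / (2 v)] of the time coordinate [G], since the Jacobian
    [1 / |sigma|] is common to both densities. *)
Lemma KL_relative_fisher_shifted_flow (d : measure_display)
  (T : measurableType d) (R : realType) (P : probability T R)
  (Z X Y : {RV P >-> R}) (sigma G : R -> R) (c v : R) :
  0 < v -> is_density Z (normal_pdf 0 (Num.sqrt v)) ->
  P.-integrable setT (EFin \o Z) -> (\int[P]_w (Z w)%:E = 0)%E ->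
  (forall y, derivable sigma y 1) -> (forall y, sigma y != 0) ->
  (forall y, is_derive y (1 : R) G (sigma y)^-1) ->
  {ae P, forall w, Z w = G (X w)} ->
  {ae P, forall w, Z w = G (Y w) - c} ->
  [/\ regular_density X (density X),
      regular_density Y (density Y),
      KL X Y = (c ^+ 2 / (2 * v))%:E &
      relative_fisher (fun x => sigma x ^+ 2) X Y = (c ^+ 2 / v ^+ 2)%:E].
Proof.
move=> v0 dZ iZ EZ dsigma sigma0 dG ZGX ZGY.
have cG : continuous G := is_derive_continuous dG.
have sv0 : Num.sqrt v != 0 by rewrite sqrtr_eq0 -ltNge.
have dGc y : is_derive y (1 : R) (fun y => G y - c) (sigma y)^-1.
  by have := dG y => dGy; apply: is_derive_eq; rewrite subr0.
have [XE rX] := flow_density sv0 dZ dsigma sigma0 dG ZGX.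
have [YE rY] := flow_density sv0 dZ dsigma sigma0 dGc ZGY.
have X0 y : 0 < density X y by case: rX => _ /(_ y)[].
have Y0 y : 0 < density Y y by case: rY => _ /(_ y)[].
pose l y := (c ^+ 2 - 2 * c * G y) / (2 * v).
have ratioE y : density X y / density Y y = expR (l y).
  rewrite XE YE !normal_pdfE// /normal_fun sqr_sqrtr ?ltW//.
  rewrite -mulf_div divff ?mulr1 ?normr_eq0 ?invr_neq0//.
  rewrite -mulf_div divff ?mul1r ?gt_eqF ?normal_peak_gt0//.
  by rewrite -expRN -expRD; congr expR; rewrite /l; field; rewrite gt_eqF.
have cl : continuous l.
  move=> y; apply: cvgM; last exact: cvg_cst.
  apply: cvgB; first exact: cvg_cst.
  by apply: cvgM; [exact: cvg_cst|exact: cG].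
split=> //.
- rewrite /KL.
  transitivity (\int[P]_w (l (X w))%:E)%E.
    apply: eq_integral => w _; rewrite inver gt_eqF// -EFinM lne_EFin.
      by rewrite ratioE expRK.
    by rewrite divr_gt0.
  (* slope of [l] as a function of the value of [Z] *)
  pose k := - (c / v).
  transitivity (\int[P]_w (c ^+ 2 / (2 * v) + k * Z w)%:E)%E.
    apply: ae_eq_integral => //.
    + apply/measurable_EFinP; apply: measurableT_comp => //.
      exact: continuous_measurable_fun.
    + apply/measurable_EFinP; apply: measurable_funD => //.
      exact: measurable_funM.
    + apply: filterS ZGX => w -> _; congr EFin; rewrite /l /k; field.
      by rewrite gt_eqF.
  have icst := finite_measure_integrable_cst P (c ^+ 2 / (2 * v)) measurableT.
  have ikZ : P.-integrable setT (EFin \o (fun w => k * Z w)).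
    exact: (integrableZl measurableT k iZ).
  rewrite (integralD_EFin measurableT icst ikZ).
  have -> : (\int[P]_w (k * Z w)%:E = 0)%E.
    by under eq_integral do rewrite EFinM; rewrite integralZl// EZ mule0.
  rewrite adde0.
  have /= -> := integral_cst P measurableT (c ^+ 2 / (2 * v))%:E.
  by rewrite probability_setT mule1.
- rewrite /relative_fisher.
  have -> : (fun x => ln (density X x / density Y x)) = l.
    by apply/funext => y; rewrite ratioE expRK.
  have l'E y : (l^`())%classic y = - (c / v) * (sigma y)^-1.
    rewrite derive1E; have := dG y => dGy.
    have dl : is_derive y (1 : R) l (- (c / v) * (sigma y)^-1).
      apply: is_derive_eq; rewrite /GRing.scale/=.
      by field; rewrite sigma0 gt_eqF.
    by rewrite derive_val.
  have -> : (fun w => sigma (X w) ^+ 2 * (l^`())%classic (X w) ^+ 2) =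
      cst (c ^+ 2 / v ^+ 2).
    apply/funext => w; rewrite l'E/=; field.
    by rewrite gt_eqF ?sigma0.
  by rewrite expectation_cst.
Qed.

(** * Fractional Brownian motion and the evolution of the divergence *)

Lemma fBm_marginal (d : measure_display) (T : measurableType d)
  (R : realType) (P : probability T R) (H : R) (B : R -> {RV P >-> R}) (t : R) :
  0 < H -> fractional_brownian_motion H B -> 0 < t ->
  [/\ is_density (B t) (normal_pdf 0 (Num.sqrt (t `^ (2 * H)))),
      P.-integrable setT (EFin \o B t) &
      (\int[P]_w (B t w)%:E = 0)%E].
Proof.
move=> H0 [gB EB _ covB] t0; have t0' := ltW t0.
have EBt : (\int[P]_w (B t w)%:E = 0)%E.
  by have := EB t t0'; rewrite unlock.
have EBt2 : (\int[P]_w (B t w ^+ 2)%:E = (t `^ (2 * H))%:E)%E.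
  have := covB t t t0' t0'; rewrite unlock => E.
  under eq_integral do rewrite expr2.
  apply: etrans E _; rewrite subrr normr0 powR0 ?mulf_neq0 ?gt_eqF//.
  by congr EFin; field.
split=> //; last exact: integrable_of_second_moment EBt2.
apply: gaussian_centered_density => //; last exact: powR_gt0.
have := gB 1%N (fun=> t) (fun=> 1) (fun=> t0').
by under eq_fun do rewrite big_ord1 mul1r.
Qed.

Unset Implicit Arguments.
Set Strict Implicit.

Theorem theorem2p2 (R : realType) (d : measure_display) (T : measurableType d)
  (P : probability T R) (H : R) (B X Y : R -> {RV P >-> R})
  (x0 y0 : R) (sigma : R -> R)
  (H_gt0 : 0 < H) (H_lt1 : H < 1)
  (B_fBm : fractional_brownian_motion H B)
  (sigma_smooth : smooth_bounded_derivatives sigma)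
  (sigma_neq0 : forall x, sigma x != 0)
  (X_sol : sde_solution sigma x0 B X)
  (Y_sol : sde_solution sigma y0 B Y) :
  (forall t : R, 0 < t ->
    [/\ regular_density (X t) (density (X t)),
        regular_density (Y t) (density (Y t)),
        KL (X t) (Y t) \is a fin_num,
        derivable (fun s => fine (KL (X s) (Y s))) t 1 &
        (((fun s => fine (KL (X s) (Y s)))^`()%classic t)%:E =
         (- (H * t `^ (2 * H - 1)))%:E *
         relative_fisher (fun x => (sigma x ^+ 2)%R) (X t) (Y t))%E]) /\
  (forall s t : R, 0 < s -> s <= t -> (KL (X t) (Y t) <= KL (X s) (Y s))%E).
Proof.
have dsigma y : derivable sigma y 1 by case: sigma_smooth => /(_ 0%N y).
have csigma : continuous sigma.
  by move=> y; apply/differentiable_continuous/derivable1_diffP.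
have [phi [_ dphi phiX]] := X_sol; have [psi [_ dpsi psiY]] := Y_sol.
have [G [phiK dG]] := autonomous_flow_inverse csigma sigma_neq0 dphi.
have psiG := autonomous_flow_shift sigma_neq0 dpsi dG.
set c := G (psi 0) in psiG.
have at_time t (t0 : 0 < t) : [/\ regular_density (X t) (density (X t)),
    regular_density (Y t) (density (Y t)),
    KL (X t) (Y t) = (c ^+ 2 / (2 * t `^ (2 * H)))%:E &
    relative_fisher (fun x => sigma x ^+ 2) (X t) (Y t) =
      (c ^+ 2 / (t `^ (2 * H)) ^+ 2)%:E].
  have [dB iB EB] := fBm_marginal H_gt0 B_fBm t0.
  apply: (KL_relative_fisher_shifted_flow (powR_gt0 _ t0) dB iB EB dsigma
    sigma_neq0 dG).
  - by apply: filterS phiX => w /(_ t (ltW t0)) ->; rewrite phiK.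
  - by apply: filterS psiY => w /(_ t (ltW t0)) ->; rewrite psiG addrK.
have KLE t : 0 < t -> fine (KL (X t) (Y t)) = c ^+ 2 / 2 * t `^ (- (2 * H)).
  move=> t0; have [_ _ -> _] := at_time t t0.
  by rewrite /= powRN invfM mulrA.
split=> [t t0|s t s0 st]; last first.
  have [_ _ -> _] := at_time s s0.
  have [_ _ -> _] := at_time t (lt_le_trans s0 st).
  rewrite lee_fin ler_wpM2l ?sqr_ge0// lef_pV2 ?posrE ?mulr_gt0 ?powR_gt0//.
    rewrite ler_pM2l// ge0_ler_powR ?nnegrE ?mulr_ge0 ?(ltW H_gt0) ?(ltW s0)//.
    exact: le_trans (ltW s0) st.
  exact: lt_le_trans s0 st.
have [rX rY KLt Jt] := at_time t t0.
have dKL : is_derive t (1 : R) (fun s => fine (KL (X s) (Y s)))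
    (- (H * t `^ (2 * H - 1)) * (c ^+ 2 / (t `^ (2 * H)) ^+ 2)).
  apply: (@near_eq_is_derive _ _ _ (fun s => c ^+ 2 / 2 * s `^ (- (2 * H)))).
    by near=> s; rewrite KLE//; near: s; exact: lt_nbhsr.
  have dpow := is_derive1_powR (- (2 * H)) t0.
  apply: is_derive_eq; rewrite /GRing.scale/=.
  have powB1 r : t `^ (r - 1) = t `^ r / t.
    by rewrite powRB ?(powRr1 (ltW t0))// (gt_eqF t0) implybT.
  rewrite !powB1 powRN; field.
  by rewrite !gt_eqF ?powR_gt0.
split=> //.
- by rewrite KLt.
- by rewrite Jt derive1E derive_val EFinM.
Unshelve. all: by end_near. Qed.
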